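(* Let $(X,\mathcal A,\sigma)$ be a measure space where $\sigma$ is a positive measure with $\sigma(X)<\infty$ and such that $\int_X|f|\,d\sigma=0$ implies $f=0$ $\sigma$-a.e., and let $\eta$ be a strictly positive measure on $[0,1]$. For membership functions $\mu,\nu:X\to[0,1]$ let \[ D(\mu,\nu)=\int_0^1\left(\int_X 1_{\mu^{-1}(\alpha,1]\,\Delta\,\nu^{-1}(\alpha,1]}(x)\,d\sigma(x)\right)d\eta(\alpha), \] and for hyperbolic-valued membership functions define \[ D_{\mathbb H}(M_{A_1,A_2},M_{B_1,B_2})=D(\mu_{A_1},\mu_{B_1})P+D(\mu_{A_2},\mu_{B_2})Q. \] Let $\mu_{A_1},\mu_{A_2},\mu_{B_1},\mu_{B_2},\mu_{C_1},\mu_{C_2}:X\to[0,1]$ and assume all integrals involved are well defined. Then \[ M_{A_1,A_2}(x)\wedge M_{B_1,B_2}(x)\le M_{C_1,C_2}(x)\le M_{A_1,A_2}(x)\vee M_{B_1,B_2}(x)\quad\text{for all }x\in X \] if and only if \[ D_{\mathbb H}(M_{A_1,A_2},M_{B_1,B_2})=D_{\mathbb H}(M_{A_1,A_2},M_{C_1,C_2})+D_{\mathbb H}(M_{C_1,C_2},M_{B_1,B_2}). \]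
   Context: $P=\frac12\begin{pmatrix}1&1\\1&1\end{pmatrix}$, $Q=\frac12\begin{pmatrix}1&-1\\-1&1\end{pmatrix}$ (so $\lambda_1P+\lambda_2Q=U\operatorname{diag}(\lambda_1,\lambda_2)U$ with $U=\frac1{\sqrt2}\begin{pmatrix}1&1\\1&-1\end{pmatrix}$). $M_{A_1,A_2}(x)=\mu_{A_1}(x)P+\mu_{A_2}(x)Q$, similarly for $B$, $C$. On matrices $\lambda_1P+\lambda_2Q$ the order is $S\le T$ iff $T-S$ is positive semi-definite, and $\wedge,\vee$ act componentwise: $(\lambda_1P+\lambda_2Q)\wedge(\mu_1P+\mu_2Q)=(\lambda_1\wedge\mu_1)P+(\lambda_2\wedge\mu_2)Q$, and likewise for $\vee$ with max. $\mu^{-1}(\alpha,1]=\{x:\alpha<\mu(x)\le1\}$ is the strong $\alpha$-cut and $\Delta$ the symmetric difference.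
   Formalization: The converse is false pointwise (change one membership function at a null point), so the equivalence is proved with betweenness for σ-a.e. x; the ''for all x'' version is proved when ∫|f|dσ=0 implies f=0 at every point. *)

(* Defs.v *)
From HB Require Import structures.
From mathcomp Require Import all_boot all_order all_algebra.
From mathcomp Require Import all_classical all_reals all_analysis.
From mathcomp Require Import ring.
Set Implicit Arguments.
Unset Strict Implicit.
Unset Printing Implicit Defensive.
Import Order.TTheory GRing.Theory Num.Theory.
Import numFieldNormedType.Exports.

Local Open Scope classical_set_scope.
Local Open Scope ring_scope.

Section Hyperbolic.
Context {R : realType}.

Definition hypP : 'M[R]_2 := 2^-1 *: const_mx 1.

Definition hypQ : 'M[R]_2 :=
  2^-1 *: \matrix_(i < 2, j < 2) (if i == j then 1 else -1).

Definition hyp (l1 l2 : R) : 'M[R]_2 := l1 *: hypP + l2 *: hypQ.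

(* The coefficients of S = l1 P + l2 Q are recovered from its first row
   ((l1 + l2) / 2, (l1 - l2) / 2); see hyp_coord1K and hyp_coord2K. *)
Definition hyp_coord1 (S : 'M[R]_2) : R := S 0 0 + S 0 1.
Definition hyp_coord2 (S : 'M[R]_2) : R := S 0 0 - S 0 1.

(* Only meaningful on matrices of the form l1 P + l2 Q; see hyp_meetE and
   hyp_joinE. *)
Definition hyp_meet (S T : 'M[R]_2) : 'M[R]_2 :=
  hyp (Num.min (hyp_coord1 S) (hyp_coord1 T))
      (Num.min (hyp_coord2 S) (hyp_coord2 T)).

Definition hyp_join (S T : 'M[R]_2) : 'M[R]_2 :=
  hyp (Num.max (hyp_coord1 S) (hyp_coord1 T))
      (Num.max (hyp_coord2 S) (hyp_coord2 T)).

Definition psdmx (n : nat) (S : 'M[R]_n) : Prop :=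
  S^T = S /\ forall v : 'cV[R]_n, 0 <= (v^T *m S *m v) 0 0.

Definition hyp_le (S T : 'M[R]_2) : Prop := psdmx (T - S).

Lemma hyp_coord1K (l1 l2 : R) : hyp_coord1 (hyp l1 l2) = l1.
Proof. by rewrite /hyp_coord1 !mxE /=; field. Qed.

Lemma hyp_coord2K (l1 l2 : R) : hyp_coord2 (hyp l1 l2) = l2.
Proof. by rewrite /hyp_coord2 !mxE /=; field. Qed.

Lemma hyp_meetE (l1 l2 m1 m2 : R) :
  hyp_meet (hyp l1 l2) (hyp m1 m2) = hyp (Num.min l1 m1) (Num.min l2 m2).
Proof. by rewrite /hyp_meet !hyp_coord1K !hyp_coord2K. Qed.

Lemma hyp_joinE (l1 l2 m1 m2 : R) :
  hyp_join (hyp l1 l2) (hyp m1 m2) = hyp (Num.max l1 m1) (Num.max l2 m2).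
Proof. by rewrite /hyp_join !hyp_coord1K !hyp_coord2K. Qed.

End Hyperbolic.

Section FuzzyDistance.
Context {d : measure_display} {X : measurableType d} {R : realType}.

Definition membership (mu : X -> R) : Prop := forall x, 0 <= mu x <= 1.

Definition hyp_membership (mu1 mu2 : X -> R) (x : X) : 'M[R]_2 :=
  hyp (mu1 x) (mu2 x).

Definition strong_cut (mu : X -> R) (a : R) : set X :=
  [set x | a < mu x <= 1].

(* `+` is the symmetric difference of sets. *)
Definition cut_symdiff (mu nu : X -> R) (a : R) : set X :=
  strong_cut mu a `+` strong_cut nu a.

Context (sigma : {measure set X -> \bar R}).

(* A measure on [0,1] is represented by a Borel measure on R of which only
   the restriction to [0,1] is ever used. *)
Context (eta : {measure set (measurableTypeR R) -> \bar R}).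

Definition strictly_positive01 : Prop :=
  forall U : set R, open U -> U `&` `[0, 1] !=set0 ->
    (0 < eta (U `&` `[0%R, 1%R]))%E.

Definition fuzzy_dist (mu nu : X -> R) : R :=
  \int[eta]_(a in `[0, 1]) (\int[sigma]_x \1_(cut_symdiff mu nu a) x).

(* The two integrals in fuzzy_dist exist and are finite, so that fuzzy_dist
   is not a default value. *)
Definition fuzzy_dist_defined (mu nu : X -> R) : Prop :=
  (forall a : R, 0 <= a <= 1 ->
     sigma.-integrable setT (EFin \o (\1_(cut_symdiff mu nu a) : X -> R))) /\
  eta.-integrable `[0, 1]
    (fun a => (\int[sigma]_x (\1_(cut_symdiff mu nu a) x : R))%:E).

Definition hyp_dist (muA1 muA2 muB1 muB2 : X -> R) : 'M[R]_2 :=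
  fuzzy_dist muA1 muB1 *: hypP + fuzzy_dist muA2 muB2 *: hypQ.

End FuzzyDistance.

(* Main.v *)
(* In the coordinates of P and Q both sides split into two scalar statements.
   For scalar membership functions A, B, C and a level t, let E_t and F_t be the
   symmetric differences of the t-cuts of A, C and of C, B. Then E_t + F_t, with
   + the symmetric difference, is that of the t-cuts of A, B, so that
     sigma(E_t) + sigma(F_t) = sigma(E_t + F_t) + 2 sigma(E_t & F_t)
   integrates to D(A, C) + D(C, B) = D(A, B) + 2 \int sigma(E_t & F_t) d eta(t).
   Hence D is additive iff sigma(E_t & F_t) = 0 for eta-almost every t in [0,1].
   Now E_t & F_t is the set of the x for which t separates C x from both A x and
   B x. If C x is not between A x and B x, then a whole interval of levels does
   so. As eta charges every interval, the levels with sigma(E_t & F_t) = 0 are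
   dense in [0,1], and countably many of the null sets E_t & F_t cover all
   such x. *)
Require Import Defs.
From mathcomp Require Import all_boot all_order all_algebra.
From mathcomp Require Import all_classical all_reals all_analysis.
From mathcomp Require Import measurable_realfun ring lra.
Set Implicit Arguments.
Unset Strict Implicit.
Unset Printing Implicit Defensive.
Import Order.TTheory GRing.Theory Num.Theory.
Import numFieldNormedType.Exports.
Local Open Scope classical_set_scope.
Local Open Scope ring_scope.

Lemma real_second_countable (R : realType) : @second_countable R.
Proof.
pose ratr_itv (pq : rat * rat) : set R := `]ratr pq.1, ratr pq.2[%classic.
exists (range ratr_itv).
  exact: sub_countable (card_image_le _ _) (countableP _).
split=> [_ [pq _ <-]|x B /nbhs_ballP[e /= e0 xeB]]; first exact: itv_open.
have [p /[!in_itv]/=/andP[xp px]] := @rat_in_itvoo R (x - e) x ltac:(lra).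
have [q /[!in_itv]/=/andP[xq qx]] := @rat_in_itvoo R x (x + e) ltac:(lra).
exists (ratr_itv (p, q)); first split; first by exists (p, q).
  by rewrite /ratr_itv /= in_itv /= px xq.
move=> y; rewrite /ratr_itv /= in_itv /= => /andP[py yq]; apply: xeB.
by rewrite /ball /= ltr_distlC; apply/andP; split; lra.
Qed.

Lemma second_countable_subset_separable (T : topologicalType) (D : set T) :
  @second_countable T ->
  exists S : set T, [/\ countable S, S `<=` D & D `<=` closure S].
Proof.
move=> [B countB [_ basisB]].
have [->|[x0 _]] : D = set0 \/ D !=set0.
  by have [->|/set0P] := eqVneq D set0; [left|right].
  by exists set0; split.
have /choice[pick pickP] : forall U, exists x, U `&` D !=set0 -> (U `&` D) x.
  move=> U; have [[x UDx]|UD0] := pselect (U `&` D !=set0); first by exists x.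
  by exists x0.
exists (pick @` [set U | B U /\ U `&` D !=set0]); split.
- apply: sub_countable (card_image_le _ _) _.
  by apply: sub_countable countB; apply: subset_card_le => U [].
- by move=> _ [U [_ /pickP[_ Dx]] <-].
- move=> x Dx V /basisB[U [BU Ux] UV].
  have UD : U `&` D !=set0 by exists x.
  by exists (pick U); split; [exists U|have [/UV] := pickP _ UD].
Qed.

Section MeasureTheory.
Context {d : measure_display} {T : measurableType d} {R : realType}.
Variable mu : {measure set T -> \bar R}.

Lemma measureY (E F : set T) : measurable E -> measurable F ->
  (mu E + mu F = mu (E `+` F) + 2%:E * mu (E `&` F))%E.
Proof.
move=> mE mF; rewrite setY_def measureU; last 3 first.
- exact: measurableD.
- exact: measurableD.
- by apply/seteqP; split=> // x [[Ex _] [_ /(_ Ex)]].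
rewrite (measureDI mu mE mF) (measureDI mu mF mE) [F `&` E]setIC.
by rewrite addeACA -mule2n -mule_natl.
Qed.

Lemma negligible_bigcup_countable (I : Type) (S : set I) (F : I -> set T) :
  countable S -> (forall i, S i -> mu.-negligible (F i)) ->
  mu.-negligible (\bigcup_(i in S) F i).
Proof.
move=> /pfcard_geP[->|/unsquash f] F0.
  by rewrite bigcup_set0; exact: negligible_set0.
rewrite (reindex_bigcup f setT)//.
by apply: negligible_bigcup => n; apply: F0; exact: funS.
Qed.

Lemma ae_forall (P : T -> Prop) :
  (forall f : T -> R, measurable_fun setT f ->
     (\int[mu]_x `|f x|%:E = 0)%E -> forall x, f x = 0) ->
  {ae mu, forall x, P x} -> forall x, P x.
Proof.
move=> faithful [N [mN N0 subN]] x; apply: contrapT => /subN Nx.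
have : \1_N x = 0 :> R.
  apply: faithful; first exact: measurable_indic.
  under eq_integral do rewrite ger0_norm//.
  by rewrite integral_indic// setIT.
by rewrite indicE mem_set// => /eqP; rewrite oner_eq0.
Qed.

Lemma ge0_Rintegral_eq0 (D : set T) (f : T -> R) :
  measurable D -> mu.-integrable D (EFin \o f) ->
  (forall x, D x -> 0 <= f x) ->
  \int[mu]_(x in D) f x = 0 <-> {ae mu, forall x, D x -> f x = 0}.
Proof.
move=> mD intf f0.
have normf :
    (\int[mu]_(x in D) `|(EFin \o f) x| = (\int[mu]_(x in D) f x)%:E)%E.
  rewrite fineK; last exact: integrable_fin_num.
  by apply: eq_integral => x /set_mem/f0 fx0; rewrite gee0_abs ?lee_fin.
have := ae_eq_integral_abs mu mD (measurable_int _ intf); rewrite normf => ae0.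
split=> [int0|fae].
- have : ae_eq mu D (EFin \o f) (cst 0%E) by apply/ae0; rewrite int0.
  by apply: filterS => x /[apply] -[].
- by apply: EFin_inj; apply/ae0; apply: filterS fae => x /[apply] /= ->.
Qed.

End MeasureTheory.

Section HyperbolicOrder.
Context {R : realType}.
Implicit Types l m : R.

Lemma hypB l1 l2 m1 m2 : hyp l1 l2 - hyp m1 m2 = hyp (l1 - m1) (l2 - m2).
Proof. by rewrite /hyp opprD addrACA -!scalerBl. Qed.

Lemma hypD l1 l2 m1 m2 : hyp l1 l2 + hyp m1 m2 = hyp (l1 + m1) (l2 + m2).
Proof. by rewrite /hyp addrACA -!scalerDl. Qed.

Lemma hyp_inj l1 l2 m1 m2 : hyp l1 l2 = hyp m1 m2 -> l1 = m1 /\ l2 = m2.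
Proof.
move=> eq_hyp; split.
- by rewrite -(hyp_coord1K l1 l2) eq_hyp hyp_coord1K.
- by rewrite -(hyp_coord2K l1 l2) eq_hyp hyp_coord2K.
Qed.

Lemma hyp_eqD l1 l2 m1 m2 n1 n2 :
  hyp l1 l2 = hyp m1 m2 + hyp n1 n2 <-> l1 = m1 + n1 /\ l2 = m2 + n2.
Proof. by rewrite hypD; split=> [/hyp_inj|[-> ->]]. Qed.

Lemma hyp_quadratic_form l1 l2 (v : 'cV[R]_2) :
  (v^T *m hyp l1 l2 *m v) 0 0 =
  l1 / 2 * (v 0 0 + v 1 0) ^+ 2 + l2 / 2 * (v 0 0 - v 1 0) ^+ 2.
Proof.
rewrite !mxE !big_ord_recl big_ord0 !mxE !big_ord_recl !big_ord0 !mxE /=.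
have -> : lift (0 : 'I_2) (0 : 'I_1) = 1 by apply/val_inj.
by field.
Qed.

Lemma psdmx_hyp l1 l2 : psdmx (hyp l1 l2) <-> 0 <= l1 /\ 0 <= l2.
Proof.
split=> [[_ psd]|[l1_ge0 l2_ge0]].
- have := psd (\col_i 1); have := psd (\col_i (if i == 0 then 1 else -1)).
  rewrite !hyp_quadratic_form !mxE /=; lra.
- split=> [|v]; first by apply/matrixP => i j; rewrite !mxE /= eq_sym.
  by rewrite hyp_quadratic_form addr_ge0// mulr_ge0// ?sqr_ge0// divr_ge0.
Qed.

Lemma hyp_leE l1 l2 m1 m2 :
  hyp_le (hyp l1 l2) (hyp m1 m2) <-> l1 <= m1 /\ l2 <= m2.
Proof. by rewrite /hyp_le hypB psdmx_hyp !subr_ge0. Qed.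

End HyperbolicOrder.

Section Betweenness.
Context {R : realDomainType}.
Implicit Types a b c t : R.

Definition between a b c : bool := Num.min a b <= c <= Num.max a b.

Definition separating a b c t : bool :=
  (c <= t < Num.min a b) || (Num.max a b <= t < c).

Lemma between_Nseparating a b c t : between a b c -> ~~ separating a b c t.
Proof.
move=> /andP[min_c c_max]; rewrite negb_or !negb_and -!ltNge -!leNgt.
have [c_le_t|t_lt_c] := leP c t; first by rewrite (le_trans min_c) ?orbT.
by rewrite (lt_le_trans t_lt_c).
Qed.

Lemma Nbetween_separating a b c : ~~ between a b c ->
  exists u v, u < v /\ forall t, u < t < v -> separating a b c t.
Proof.
rewrite negb_and -!ltNge => /orP[c_min|max_c].
- exists c, (Num.min a b); split=> // t /andP[/ltW ct tmin].
  by rewrite /separating ct tmin.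
- exists (Num.max a b), c; split=> // t /andP[/ltW maxt tc].
  by rewrite /separating maxt tc orbT.
Qed.

Lemma separating_ge0_le1 a b c t :
  0 <= a <= 1 -> 0 <= b <= 1 -> 0 <= c <= 1 ->
  separating a b c t -> 0 <= t <= 1.
Proof. by rewrite /separating lt_min ge_max; lra. Qed.

End Betweenness.

Lemma hyp_betweenE (R : realType) (a1 a2 b1 b2 c1 c2 : R) :
  hyp_le (hyp_meet (hyp a1 a2) (hyp b1 b2)) (hyp c1 c2) /\
  hyp_le (hyp c1 c2) (hyp_join (hyp a1 a2) (hyp b1 b2)) <->
  between a1 b1 c1 /\ between a2 b2 c2.
Proof.
rewrite hyp_meetE hyp_joinE !hyp_leE.
split=> [[[? ?] [? ?]]|[/andP[? ?] /andP[? ?]]]; last by split.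
by split; apply/andP.
Qed.

Section CutOverlap.
Context {d : measure_display} {X : measurableType d} {R : realType}.
Implicit Types (A B C : X -> R) (t : R).

Definition cut_overlap A B C t : set X :=
  cut_symdiff A C t `&` cut_symdiff C B t.

Lemma cut_symdiff_trans A B C t :
  cut_symdiff A C t `+` cut_symdiff C B t = cut_symdiff A B t.
Proof.
by rewrite /cut_symdiff -setYA (setYA (strong_cut C t)) setYK set0Y.
Qed.

Lemma cut_overlapE A B C t (x : X) :
  membership A -> membership B -> membership C ->
  cut_overlap A B C t x <-> separating (A x) (B x) (C x) t.
Proof.
move=> mA mB mC; rewrite /cut_overlap /cut_symdiff /strong_cut /separating /=.
have /andP[_ ->] := mA x; have /andP[_ ->] := mB x; have /andP[_ ->] := mC x.
rewrite lt_min ge_max !andbT.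
by case: (ltP t (A x)); case: (ltP t (B x)); case: (ltP t (C x));
  move=> _ _ _ /=; intuition.
Qed.

End CutOverlap.

Section FuzzyDistanceExcess.
Context {d : measure_display} {X : measurableType d} {R : realType}.
Variable sigma : {measure set X -> \bar R}.
Variable eta : {measure set (measurableTypeR R) -> \bar R}.
Implicit Types (mu nu : X -> R) (t : R).

Definition cut_dist mu nu t : R := \int[sigma]_x \1_(cut_symdiff mu nu t) x.

Lemma measurable_cut_symdiff mu nu t :
  fuzzy_dist_defined sigma eta mu nu -> 0 <= t <= 1 ->
  measurable (cut_symdiff mu nu t).
Proof.
by move=> [intmu _] /intmu /measurable_int/measurable_EFinP/measurable_indicP.
Qed.

Lemma cut_distE mu nu t :
  fuzzy_dist_defined sigma eta mu nu -> 0 <= t <= 1 ->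
  (cut_dist mu nu t)%:E = sigma (cut_symdiff mu nu t).
Proof.
move=> def t01; have mE := measurable_cut_symdiff def t01.
rewrite fineK; last exact: integrable_fin_num (def.1 t t01).
by rewrite integral_indic// setIT.
Qed.

Variables A B C : X -> R.
Hypothesis AB : fuzzy_dist_defined sigma eta A B.
Hypothesis AC : fuzzy_dist_defined sigma eta A C.
Hypothesis CB : fuzzy_dist_defined sigma eta C B.

Definition cut_excess t : R :=
  cut_dist A C t + cut_dist C B t - cut_dist A B t.

Lemma measurable_cut_overlap t :
  0 <= t <= 1 -> measurable (cut_overlap A B C t).
Proof. by move=> t01; apply: measurableI; exact: measurable_cut_symdiff. Qed.

Lemma cut_excessE t : 0 <= t <= 1 ->
  (cut_excess t)%:E = (2%:E * sigma (cut_overlap A B C t))%E.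
Proof.
move=> t01.
have := measureY sigma (measurable_cut_symdiff AC t01)
                       (measurable_cut_symdiff CB t01).
rewrite cut_symdiff_trans -!cut_distE// -EFinD => excess.
by rewrite EFinB excess addeAC subee ?add0e.
Qed.

Lemma cut_excess_ge0 t : 0 <= t <= 1 -> 0 <= cut_excess t.
Proof. by move=> t01; rewrite -lee_fin cut_excessE// mule_ge0. Qed.

Lemma cut_excess_eq0 t : 0 <= t <= 1 ->
  cut_excess t = 0 <-> sigma.-negligible (cut_overlap A B C t).
Proof.
move=> t01; rewrite negligibleP; last exact: measurable_cut_overlap.
have excessE := cut_excessE t01; split=> [excess0|sigma0].
- by move/esym/eqP: excessE; rewrite excess0 mule_eq0 eqe pnatr_eq0 => /eqP.
- by apply: EFin_inj; rewrite excessE sigma0 mule0.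
Qed.

Let measurable01 : measurable (`[0, 1] : set (measurableTypeR R)).
Proof. exact: measurable_itv. Qed.

Lemma integrable_cut_excess : eta.-integrable `[0, 1] (EFin \o cut_excess).
Proof.
exact: (integrableB measurable01 (integrableD measurable01 AC.2 CB.2) AB.2).
Qed.

Lemma fuzzy_dist_excess :
  \int[eta]_(t in `[0, 1]) cut_excess t =
  fuzzy_dist sigma eta A C + fuzzy_dist sigma eta C B
  - fuzzy_dist sigma eta A B.
Proof.
rewrite /fuzzy_dist -RintegralD//; [|exact: AC.2|exact: CB.2].
rewrite -RintegralB//; last exact: AB.2.
exact: (integrableD measurable01 AC.2 CB.2).
Qed.

Lemma fuzzy_dist_additiveE :
  fuzzy_dist sigma eta A B =
    fuzzy_dist sigma eta A C + fuzzy_dist sigma eta C B <->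
  {ae eta, forall t : R,
    0 <= t <= 1 -> sigma.-negligible (cut_overlap A B C t)}.
Proof.
have -> : fuzzy_dist sigma eta A B =
    fuzzy_dist sigma eta A C + fuzzy_dist sigma eta C B <->
    \int[eta]_(t in `[0, 1]) cut_excess t = 0.
  rewrite fuzzy_dist_excess; split=> [->|/eqP]; first exact: subrr.
  by rewrite subr_eq0 => /eqP.
rewrite ge0_Rintegral_eq0//; last 2 first.
- exact: integrable_cut_excess.
- by move=> t; rewrite /= in_itv; exact: cut_excess_ge0.
have excessP t : `[0, 1]%classic t -> cut_excess t = 0 <->
    sigma.-negligible (cut_overlap A B C t).
  by rewrite /= in_itv; exact: cut_excess_eq0.
split=> ae0.
- by apply: filterS ae0 => t excess0 t01; apply/excessP => //; exact: excess0.
- apply: negligibleS ae0 => t; apply: contra_not => overlap0 t01.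
  by apply/excessP => //; exact: overlap0.
Qed.

End FuzzyDistanceExcess.

Section FuzzyBetweenness.
Context {d : measure_display} {X : measurableType d} {R : realType}.
Variable sigma : {measure set X -> \bar R}.
Variable eta : {measure set (measurableTypeR R) -> \bar R}.
Hypothesis eta_pos : strictly_positive01 eta.

Lemma closure_ae01 (P : R -> Prop) :
  {ae eta, forall t : R, 0 <= t <= 1 -> P t} ->
  `[0, 1] `<=` closure [set t | 0 <= t <= 1 /\ P t].
Proof.
move=> aeP t t01 V tV; apply: contrapT => noP.
have : (0 < eta (V° `&` `[0%R, 1%R]))%E.
  by apply: eta_pos; [exact: open_interior|exists t].
rewrite lt0e => /andP[/eqP + _]; apply; apply/negligibleP.
  apply: measurableI; last exact: measurable_itv.
  by apply: open_measurable; exact: open_interior.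
apply: negligibleS aeP => s [/interior_subset Vs].
rewrite /= in_itv /= => s01 /(_ s01) Ps.
by apply: noP; exists s.
Qed.

Lemma countable_dense_ae01 (P : R -> Prop) :
  {ae eta, forall t : R, 0 <= t <= 1 -> P t} ->
  exists S : set R, [/\ countable S, S `<=` P & `[0, 1] `<=` closure S].
Proof.
move=> /closure_ae01; set D := [set t | _ /\ P t] => denseD.
have [S [countS SD DS]] :=
  second_countable_subset_separable D (@real_second_countable R).
exists S; split=> // [t /SD[]//|].
rewrite ((closure_id _).1 (@closed_closure _ S)).
exact: subset_trans denseD (closureS DS).
Qed.

Variables A B C : X -> R.
Hypotheses (mA : membership A) (mB : membership B) (mC : membership C).

Lemma Nbetween_cut_overlap (S : set R) (x : X) :
  `[0, 1] `<=` closure S -> ~~ between (A x) (B x) (C x) ->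
  exists2 t, S t & cut_overlap A B C t x.
Proof.
move=> denseS /Nbetween_separating[u [v [uv uv_sep]]].
have midP : u < (u + v) / 2 < v by lra.
have [||t [St]] := denseS ((u + v) / 2) _ `]u, v[%classic.
- by rewrite /= in_itv /=; exact: separating_ge0_le1 (uv_sep _ midP).
- by apply: open_nbhs_nbhs; split; [exact: itv_open|rewrite /= in_itv].
rewrite /= in_itv => /uv_sep sep.
by exists t => //; apply/cut_overlapE.
Qed.

Lemma ae_negligible_cut_overlap :
  {ae eta, forall t : R,
    0 <= t <= 1 -> sigma.-negligible (cut_overlap A B C t)} <->
  {ae sigma, forall x, between (A x) (B x) (C x)}.
Proof.
split=> [/countable_dense_ae01[S [countS overlap0 denseS]]|btw].
- have := negligible_bigcup_countable countS overlap0.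
  apply: negligibleS => x /= /negP /(Nbetween_cut_overlap denseS)[t St Ox].
  by exists t.
- apply: aeW => t _; apply: negligibleS btw => x.
  by move=> /cut_overlapE-/(_ mA mB mC) sep /(between_Nseparating t)/negP.
Qed.

Lemma ae_betweenE :
  fuzzy_dist_defined sigma eta A B -> fuzzy_dist_defined sigma eta A C ->
  fuzzy_dist_defined sigma eta C B ->
  {ae sigma, forall x, between (A x) (B x) (C x)} <->
  fuzzy_dist sigma eta A B =
    fuzzy_dist sigma eta A C + fuzzy_dist sigma eta C B.
Proof.
by move=> AB AC CB; rewrite fuzzy_dist_additiveE// ae_negligible_cut_overlap.
Qed.

End FuzzyBetweenness.

Lemma hyp_dist_additiveE (d : measure_display) (X : measurableType d)
    (R : realType) (sigma : {measure set X -> \bar R})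
    (eta : {measure set (measurableTypeR R) -> \bar R})
    (A1 A2 B1 B2 C1 C2 : X -> R) :
  hyp_dist sigma eta A1 A2 B1 B2 =
    hyp_dist sigma eta A1 A2 C1 C2 + hyp_dist sigma eta C1 C2 B1 B2 <->
  fuzzy_dist sigma eta A1 B1 =
    fuzzy_dist sigma eta A1 C1 + fuzzy_dist sigma eta C1 B1 /\
  fuzzy_dist sigma eta A2 B2 =
    fuzzy_dist sigma eta A2 C2 + fuzzy_dist sigma eta C2 B2.
Proof. exact: hyp_eqD. Qed.

Theorem theorem11p6 (R : realType) (d : measure_display) (X : measurableType d)
  (sigma : {measure set X -> \bar R})
  (eta : {measure set (measurableTypeR R) -> \bar R})
  (muA1 muA2 muB1 muB2 muC1 muC2 : X -> R)
  (sigma_finite_mass : (sigma setT < +oo)%E)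
  (sigma_ae : forall f : X -> R, measurable_fun setT f ->
     (\int[sigma]_x `|f x|%:E = 0)%E -> {ae sigma, forall x, f x = 0})
  (eta_pos : strictly_positive01 eta)
  (mA1 : membership muA1) (mA2 : membership muA2)
  (mB1 : membership muB1) (mB2 : membership muB2)
  (mC1 : membership muC1) (mC2 : membership muC2)
  (AB1 : fuzzy_dist_defined sigma eta muA1 muB1)
  (AB2 : fuzzy_dist_defined sigma eta muA2 muB2)
  (AC1 : fuzzy_dist_defined sigma eta muA1 muC1)
  (AC2 : fuzzy_dist_defined sigma eta muA2 muC2)
  (CB1 : fuzzy_dist_defined sigma eta muC1 muB1)
  (CB2 : fuzzy_dist_defined sigma eta muC2 muB2) :
  let MA := hyp_membership muA1 muA2 in
  let MB := hyp_membership muB1 muB2 in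
  let MC := hyp_membership muC1 muC2 in
  let between := fun x : X =>
    hyp_le (hyp_meet (MA x) (MB x)) (MC x) /\
    hyp_le (MC x) (hyp_join (MA x) (MB x)) in
  let dist_additive :=
    hyp_dist sigma eta muA1 muA2 muB1 muB2 =
    hyp_dist sigma eta muA1 muA2 muC1 muC2 +
    hyp_dist sigma eta muC1 muC2 muB1 muB2 in
  ({ae sigma, forall x, between x} <-> dist_additive) /\
  ((forall f : X -> R, measurable_fun setT f ->
      (\int[sigma]_x `|f x|%:E = 0)%E -> forall x, f x = 0) ->
   ((forall x, between x) <-> dist_additive)).
Proof.
move=> MA MB MC btw dist_additive.
have btwE x :
    btw x <-> between (muA1 x) (muB1 x) (muC1 x) /\
              between (muA2 x) (muB2 x) (muC2 x) by exact: hyp_betweenE.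
have aeE : {ae sigma, forall x, btw x} <-> dist_additive.
  have [additive1 ae1] := ae_betweenE eta_pos mA1 mB1 mC1 AB1 AC1 CB1.
  have [additive2 ae2] := ae_betweenE eta_pos mA2 mB2 mC2 AB2 AC2 CB2.
  rewrite /dist_additive hyp_dist_additiveE.
  split=> [ae_btw|[/ae1 btw1 /ae2 btw2]].
  - split; [apply: additive1|apply: additive2];
      by apply: filterS ae_btw => x /btwE[].
  - by apply: filterS2 btw1 btw2 => x ? ?; apply/btwE.
split=> // faithful; rewrite -aeE.
by split; [exact: aeW|exact: ae_forall].
Qed.
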